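(* Let $\mathcal S=(\mathcal U,\tilde\varphi,(\iota^{(i)})_{i\ge1})$ be a spreadability system for a $\mathcal B$-valued noncommutative probability space $(\mathcal A,\varphi)$. For $\pi\in\mathcal{OP}_n$ with $p$ blocks and $X_1,\dots,X_n\in\mathcal A$ let $K_\pi(X_1,\dots,X_n)$ be the coefficient of $N_1N_2\cdots N_p$ in the polynomial $\varphi_\pi(N_{\pi(1)}.X_1,\dots,N_{\pi(n)}.X_n)$ in $N_1,\dots,N_p$. Then the family $(K_\pi)$ satisfies the cumulant axioms (S1) (multilinearity), (S2) (universality) and (S3) (extensivity) given in the context.
   Context: Ordered set partitions. $\mathbb N=\{1,2,\dots\}$, $[n]=\{1,\dots,n\}$. An ordered set partition of $[n]$ is a sequence $\pi=(P_1,\dots,P_p)$ of pairwise disjoint nonempty blocks with union $[n]$; $|\pi|=p$; $\mathcal{OP}_n$ is the set of them; $\pi(i)$ denotes the index $k$ with $i\in P_k$; $\bar\pi$ is the underlying set partition; set partitions are ordered by refinement. For $\pi=(P_1,\dots,P_p)$, $\sigma=(S_1,\dots,S_s)$ we write $\pi\le\sigma$ iff $\bar\pi\le\bar\sigma$ and, whenever $i<j$, $P_i\subseteq S_k$, $P_j\subseteq S_l$, one has $k\le l$. The quasi-meet is $\pi\curlywedge\sigma=(P_1\cap S_1,P_1\cap S_2,\dots,P_1\cap S_s,P_2\cap S_1,\dots,P_p\cap S_s)$ with empty sets removed. The ordered kernel $\kappa(i_1,\dots,i_n)\in\mathcal{OP}_n$ has as blocks the level sets $\{k:i_k=v\}$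 listed in increasing order of $v$. Spreadability systems. Algebras are associative over $\mathbb C$. A $\mathcal B$-valued noncommutative probability space is an algebra $\mathcal A$ with a linear map $\varphi:\mathcal A\to\mathcal B$ into an algebra $\mathcal B$. A spreadability system for it is a triple $(\mathcal U,\tilde\varphi,(\iota^{(i)})_{i\ge1})$ with $\mathcal U$ an algebra, $\tilde\varphi:\mathcal U\to\mathcal B$ linear, $\iota^{(i)}:\mathcal A\to\mathcal U$ homomorphisms with $\varphi=\tilde\varphi\circ\iota^{(i)}$, such that, writing $X^{(i)}=\iota^{(i)}(X)$, $\tilde\varphi(X_1^{(i_1)}\cdots X_n^{(i_n)})=\tilde\varphi(X_1^{(h(i_1))}\cdots X_n^{(h(i_n))})$ for all $X_k\in\mathcal A$, $i_k\in\mathbb N$ and all $h:\{i_1,\dots,i_n\}\to\mathbb N$ with $i_p<i_q\Rightarrow h(i_p)<h(i_q)$. For $\pi\in\mathcal{OP}_n$, $\varphi_\pi(X_1,\dots,X_n):=\tilde\varphi(X_1^{(i_1)}\cdots X_n^{(i_n)})$ for any indices with $\kappa(i_1,\dots,i_n)=\pi$; one extends $\varphi_\pi(X_1^{(i_1)},\dots,X_n^{(i_n)}):=\varphi_{\pi\curlywedge\kappa(i_1,\dots,i_n)}(X_1,\dots,X_n)$ and $\varphi_\pi(M_1.X_1,\dots,M_n.X_n):=\sum_{i_1=1}^{M_1}\cdots\sum_{i_n=1}^{M_n}\varphi_\pi(X_1^{(i_1)},\dots,X_n^{(i_n)})$ for $M_k\in\mathbb N$. For $\pi$ with $p$ blocks,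 $\varphi_\pi(N_{\pi(1)}.X_1,\dots,N_{\pi(n)}.X_n)$ is a polynomial in $N_1,\dots,N_p$ with coefficients in $\mathcal B$. Axioms. (S1) Each $K_\pi:\mathcal A^n\to\mathcal B$ ($\pi\in\mathcal{OP}_n$, $n\in\mathbb N$) is multilinear. (S2) There are coefficients $c(\sigma,\pi)\in\mathbb C$ (depending only on $\sigma,\pi$) with $\varphi_\pi=K_\pi+\sum_{\sigma\in\mathcal{OP}_n,\sigma<\pi}c(\sigma,\pi)K_\sigma$ for every $\pi\in\mathcal{OP}_n$; equivalently there are $\tilde c(\sigma,\pi)\in\mathbb C$ with $K_\pi=\varphi_\pi+\sum_{\sigma<\pi}\tilde c(\sigma,\pi)\varphi_\sigma$. (S3) $K_\pi(N.X_1,\dots,N.X_n)=N^{|\pi|}K_\pi(X_1,\dots,X_n)$ for all $N\in\mathbb N$, $X_k\in\mathcal A$, $\pi\in\mathcal{OP}_n$, where $K_\pi(M_1.X_1,\dots,M_n.X_n):=\sum_{\sigma\le\pi}\tilde c(\sigma,\pi)\varphi_\sigma(M_1.X_1,\dots,M_n.X_n)$ with $\tilde c(\pi,\pi)=1$. *)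

(* Defs.v *)
From HB Require Import structures.
From mathcomp Require Import all_boot all_order all_algebra.
From mathcomp Require Import finmap.
From mathcomp Require Import complex.
From mathcomp Require Import reals.
From mathcomp Require classical_sets.

Set Implicit Arguments.
Unset Strict Implicit.
Unset Printing Implicit Defensive.

Import GRing.Theory.
Local Open Scope ring_scope.

(* The set [n] = {1, ..., n} is represented by 'I_n = {0, ..., n-1}. *)
Definition is_osp n (s : seq {set 'I_n}) : bool :=
  [&& set0 \notin s,
      pairwise (fun P Q : {set 'I_n} => [disjoint P & Q]) s
    & \bigcup_(P <- s) P == [set: 'I_n]].

(* A partition of 'I_n has at most n blocks (lemma [is_osp_size]), so the bound
   in [n.-bseq] is no restriction; it only makes [osp n] a finite type. *)
Record osp n := Osp {
  blocks :> n.-bseq {set 'I_n};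
  _ : is_osp blocks
}.

HB.instance Definition _ n := [isSub for @blocks n].
HB.instance Definition _ n := [Finite of osp n by <:].

Lemma ospP n (pi : osp n) : is_osp pi.
Proof. by case: pi. Qed.

Lemma is_osp_size n (s : seq {set 'I_n}) : is_osp s -> (size s <= n)%N.
Proof.
case/and3P=> s0 sd _.
suff H : (size s <= #|\bigcup_(P <- s) P|)%N.
  by apply: leq_trans H _; rewrite -[X in (_ <= X)%N]card_ord max_card.
elim: s s0 sd => [|P s IHs] //=.
rewrite inE negb_or eq_sym => /andP[P0 s0] /andP[Pd sd].
rewrite big_cons cardsU.
have -> : P :&: \bigcup_(Q <- s) Q = set0.
  rewrite big_distrr /= big1_seq // => Q /andP[_ Qs].
  by apply/eqP; rewrite setI_eq0; apply: (allP Pd).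
rewrite cards0 subn0 -add1n leq_add ?IHs //.
by rewrite card_gt0.
Qed.

Definition osp_of_seq n (s : seq {set 'I_n}) (s_osp : is_osp s) : osp n :=
  @Osp n (Bseq (is_osp_size s_osp)) s_osp.

Lemma in_bigcup_seq n (s : seq {set 'I_n}) (i : 'I_n) :
  (i \in \bigcup_(P <- s) P) = has (fun P : {set 'I_n} => i \in P) s.
Proof.
elim: s => [|P s IHs] /=; first by rewrite big_nil inE.
by rewrite big_cons inE IHs.
Qed.

Lemma osp_has n (pi : osp n) (i : 'I_n) :
  has (fun P : {set 'I_n} => i \in P) pi.
Proof.
have /and3P[_ _ /eqP/setP/(_ i)] := ospP pi.
by rewrite in_setT in_bigcup_seq.
Qed.

Lemma block_index_proof n (pi : osp n) (i : 'I_n) :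
  (find (fun P : {set 'I_n} => i \in P) pi < size pi)%N.
Proof. by rewrite -has_find osp_has. Qed.

(* pi(i), the index of the block of pi that contains i, counted from 0. *)
Definition block_index n (pi : osp n) (i : 'I_n) : 'I_(size pi) :=
  Ordinal (block_index_proof pi i).

(* Refinement of the underlying set partitions. *)
Definition osp_refines n (pi sg : osp n) : bool :=
  [forall P in [set:: pi], exists Q in [set:: sg], P \subset Q].

Definition osp_le n (pi sg : osp n) : bool :=
  osp_refines pi sg &&
  [forall i : 'I_(size pi), forall j : 'I_(size pi),
   forall k : 'I_(size sg), forall l : 'I_(size sg),
    [&& (i < j)%N, nth set0 pi i \subset nth set0 sg k
      & nth set0 pi j \subset nth set0 sg l] ==> (k <= l)%N].

Definition osp_lt n (pi sg : osp n) : bool := (pi != sg) && osp_le pi sg.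

Definition qmeet_seq n (pi sg : osp n) : seq {set 'I_n} :=
  [seq A <- [seq P :&: Q | P <- pi, Q <- sg] | A != set0].

Lemma qmeet_osp n (pi sg : osp n) : is_osp (qmeet_seq pi sg).
Proof.
have /and3P[_ sgd _] := ospP sg; have /and3P[_ pid _] := ospP pi.
apply/and3P; split.
- by rewrite mem_filter eqxx.
- apply: (subseq_pairwise (filter_subseq _ _)).
  elim: (pi : seq _) pid => [|P s IHs] //= /andP[Ps sd].
  rewrite pairwise_cat IHs // andbT; apply/andP; split.
  + apply/allrelP => _ _ /mapP[Q _ ->] /allpairsP[[P' Q'] /= [P's _ ->]].
    rewrite -setI_eq0 -subset0; apply: subset_trans (setISS (subsetIl _ _)
      (subsetIl _ _)) _.
    by rewrite subset0 setI_eq0 (allP Ps).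
  + rewrite pairwise_map; apply: sub_pairwise sgd => Q Q' QQ'.
    rewrite /= -setI_eq0 -subset0; apply: subset_trans (setISS (subsetIr _ _)
      (subsetIr _ _)) _.
    by rewrite subset0 setI_eq0.
- apply/eqP/setP => i; rewrite in_bigcup_seq in_setT.
  have /hasP[P Ppi iP] := osp_has pi i; have /hasP[Q Qsg iQ] := osp_has sg i.
  apply/hasP; exists (P :&: Q); last by rewrite inE iP.
  rewrite mem_filter; apply/andP; split; first by apply/set0Pn; exists i; rewrite inE iP.
  by apply/allpairsP; exists (P, Q).
Qed.

Definition qmeet n (pi sg : osp n) : osp n := osp_of_seq (qmeet_osp pi sg).

Definition okernel_seq n (i : 'I_n -> nat) : seq {set 'I_n} :=
  [seq [set k | i k == v] | v <- sort leq (undup [seq i k | k : 'I_n])].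

Lemma okernel_osp n (i : 'I_n -> nat) : is_osp (okernel_seq i).
Proof.
apply/and3P; split.
- apply/mapP => -[v]; rewrite mem_sort mem_undup => /mapP[k _ ->] /setP/(_ k).
  by rewrite !inE eqxx.
- rewrite pairwise_map.
  have := undup_uniq [seq i k | k : 'I_n]; rewrite -(sort_uniq leq) uniq_pairwise.
  apply: sub_pairwise => v w /= vw; rewrite -setI_eq0.
  apply/eqP/setP => k; rewrite !inE.
  by apply/negP => /andP[/eqP-> /eqP vw']; rewrite vw' eqxx in vw.
- apply/eqP/setP => k; rewrite in_bigcup_seq in_setT has_map.
  apply/hasP; exists (i k); last by rewrite /= inE.
  by rewrite mem_sort mem_undup map_f ?mem_enum.
Qed.

Definition okernel n (i : 'I_n -> nat) : osp n := osp_of_seq (okernel_osp i).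

Lemma block_indexE n (pi : osp n) (k : 'I_n) (v : nat) : (v < size pi)%N ->
  (k \in nth set0 pi v) = (block_index pi k == v :> nat).
Proof.
move=> vp; apply/idP/eqP => [kv|<-]; last first.
  exact: (nth_find set0 (osp_has pi k)).
have /and3P[_ /(pairwiseP set0) pd _] := ospP pi.
have kb := nth_find set0 (osp_has pi k); have bp := block_index_proof pi k.
apply/eqP; rewrite eqn_leq; apply/andP; split; rewrite leqNgt; apply/negP => lt.
- have /pred0P/(_ k) := pd v _ vp bp lt; by rewrite /= kv kb.
- have /pred0P/(_ k) := pd _ v bp vp lt; by rewrite /= kv kb.
Qed.

Lemma okernel_block_index n (pi : osp n) : okernel (block_index pi) = pi.
Proof.
apply/val_inj/val_inj => /=.
have /and3P[p0 _ _] := ospP pi.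
rewrite /okernel_seq; set l := [seq _ | _ : _].
have -> : sort leq (undup l) = iota 0 (size pi).
  apply: (sorted_eq leq_trans anti_leq).
  - exact: (sort_sorted leq_total).
  - exact: iota_sorted.
  rewrite perm_sort; apply: uniq_perm; rewrite ?undup_uniq ?iota_uniq // => v.
  rewrite mem_undup mem_iota /= add0n; apply/mapP/idP => [[j _ ->]|vp]; first exact: block_index_proof.
  have /set0Pn[j jP] : nth set0 pi v != set0.
    by apply: contraNneq p0 => v0; rewrite -[X in X \in _]v0 mem_nth.
  by move: jP; rewrite block_indexE // => /eqP<-; exists j => //; rewrite mem_enum.
apply: (@eq_from_nth _ set0); rewrite size_map size_iota // => v vp.
rewrite (nth_map 0%N) ?size_iota // nth_iota // add0n.
by apply/setP => k; rewrite inE block_indexE.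
Qed.

(* Associative algebras, not assumed to be unital or commutative. *)
Record assoc_alg (K : comNzRingType) := AssocAlg {
  alg_sort :> lmodType K;
  amul : alg_sort -> alg_sort -> alg_sort;
  amulA : associative amul;
  amul_linl : forall y, linear (amul^~ y);
  amul_linr : forall x, linear (amul x)
}.

(* The product X_1 ... X_n of n >= 1 factors. *)
Definition aprod (K : comNzRingType) (A : assoc_alg K) n (X : 'I_n.+1 -> A) : A :=
  foldl (@amul K A) (X ord0) [seq X (lift ord0 k) | k : 'I_n].

(* The index set {1, 2, ...} of the homomorphisms is represented by nat =
   {0, 1, ...}: [sp_iota i] is the (i+1)-st homomorphism.  Only the order of the
   indices matters in what follows. *)
Record spreadability_system (K : comNzRingType) (A B : assoc_alg K)
    (phi : {linear A -> B}) := SpreadabilitySystem {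
  spU : assoc_alg K;
  sp_phi : {linear spU -> B};
  sp_iota : nat -> {linear A -> spU};
  sp_iotaM : forall i (X Y : A),
    sp_iota i (amul X Y) = amul (sp_iota i X) (sp_iota i Y);
  sp_phi_iota : forall i (X : A), phi X = sp_phi (sp_iota i X);
  spreadable : forall n (X : 'I_n.+1 -> A) (i : 'I_n.+1 -> nat) (h : nat -> nat),
    (forall p q, (i p < i q)%N -> (h (i p) < h (i q))%N) ->
    sp_phi (aprod (fun k => sp_iota (i k) (X k))) =
    sp_phi (aprod (fun k => sp_iota (h (i k)) (X k)))
}.

Section Moments.
Context (K : comNzRingType) (A B : assoc_alg K) (phi : {linear A -> B}).
Context (S : spreadability_system phi).

(* phi_pi (X_1, ..., X_n), computed with the indices i_k := pi(k), whose ordered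
   kernel is pi ([okernel_block_index]).  By [phi_ospE] any other indices with
   the same ordered kernel give the same value. *)
Definition phi_osp n (pi : osp n.+1) (X : 'I_n.+1 -> A) : B :=
  sp_phi S (aprod (fun k => sp_iota S (block_index pi k) (X k))).

(* phi_pi (X_1^(i_1), ..., X_n^(i_n)) *)
Definition phi_osp_up n (pi : osp n.+1) (X : 'I_n.+1 -> A)
    (i : 'I_n.+1 -> nat) : B :=
  phi_osp (qmeet pi (okernel i)) X.

(* phi_pi (M_1.X_1, ..., M_n.X_n); with indices starting at 0, the k-th
   summation index ranges over {0, ..., M_k - 1}. *)
Definition phi_osp_dot n (pi : osp n.+1) (M : 'I_n.+1 -> nat)
    (X : 'I_n.+1 -> A) : B :=
  \sum_(i : {dffun forall k : 'I_n.+1, 'I_(M k)})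
    phi_osp_up pi X (fun k => i k).

Lemma phi_ospE n (pi : osp n.+1) (X : 'I_n.+1 -> A) (i : 'I_n.+1 -> nat) :
  okernel i = pi ->
  phi_osp pi X = sp_phi S (aprod (fun k => sp_iota S (i k) (X k))).
Proof.
move=> <-; set s := sort leq (undup [seq i k | k : 'I_n.+1]).
rewrite (@spreadable _ _ _ _ S n X i (fun v => seq.index v s)) => [|p q ipq].
  rewrite /phi_osp /=; congr (sp_phi S _); rewrite /aprod /block_index /=.
  have E k : find (fun P : {set 'I_n.+1} => k \in P) (okernel_seq i) =
             seq.index (i k) s.
    by rewrite find_map; apply: eq_find => v; rewrite /= inE eq_sym.
  by rewrite E; congr foldl; apply: eq_map => k; rewrite E.
have mem k : i k \in s by rewrite mem_sort mem_undup map_f ?mem_enum.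
rewrite ltnNge; apply: contraL ipq => le; rewrite -leqNgt.
have ss : sorted leq s by apply: (sort_sorted leq_total).
exact: (sorted_leq_index leq_trans leqnn ss (i q) (i p) (mem q) (mem p) le).
Qed.

End Moments.

(* Polynomials in p variables with coefficients in V: finitely supported
   families of coefficients, indexed by the exponents of the monomials. *)
Definition vpoly (p : nat) (V : zmodType) :=
  {fsfun {ffun 'I_p -> nat} -> V with 0}.

Definition vpoly_eval (p : nat) (V : zmodType) (f : vpoly p V)
    (N : 'I_p -> nat) : V :=
  \sum_(m <- finsupp f) f m *+ (\prod_(k < p) N k ^ m k)%N.

Section Cumulants.
Context (K : comNzRingType) (A B : assoc_alg K) (phi : {linear A -> B}).
Context (S : spreadability_system phi).

Definition is_dot_poly n (pi : osp n.+1) (X : 'I_n.+1 -> A)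
    (f : vpoly (size pi) B) : Prop :=
  forall N : 'I_(size pi) -> nat, (forall k, (0 < N k)%N) ->
    phi_osp_dot S pi (fun k => N (block_index pi k)) X = vpoly_eval f N.

(* The polynomial phi_pi (N_{pi(1)}.X_1, ..., N_{pi(n)}.X_n) in N_1, ..., N_p;
   the default value 0 of [xget] is not used when such a polynomial exists. *)
Definition dot_poly n (pi : osp n.+1) (X : 'I_n.+1 -> A) : vpoly (size pi) B :=
  classical_sets.xget [fsfun with 0] (@is_dot_poly n pi X).

Definition cumulant n (pi : osp n.+1) (X : 'I_n.+1 -> A) : B :=
  dot_poly pi X [ffun => 1%N].

End Cumulants.

Section CumulantAxioms.
Context (K : comNzRingType) (A B : assoc_alg K) (phi : {linear A -> B}).
Context (S : spreadability_system phi).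
Context (kappa : forall n, osp n.+1 -> ('I_n.+1 -> A) -> B).
Context (c ct : forall n, osp n.+1 -> osp n.+1 -> K).

Definition multilinearity : Prop :=
  forall n (pi : osp n.+1) (X : 'I_n.+1 -> A) (k : 'I_n.+1),
    linear (fun x : A => kappa pi [eta X with k |-> x]).

(* Here [c] and [ct] are the coefficients c(sigma, pi) and c~(sigma, pi);
   that they depend on sigma and pi only is a matter of where they are
   quantified. *)
Definition universality : Prop :=
  [/\ forall n (pi : osp n.+1) X,
        phi_osp S pi X =
        kappa pi X + \sum_(sg : osp n.+1 | osp_lt sg pi) c sg pi *: kappa sg X,
      forall n (pi : osp n.+1), ct pi pi = 1
    & forall n (pi : osp n.+1) X,
        kappa pi X =
        phi_osp S pi X +
        \sum_(sg : osp n.+1 | osp_lt sg pi) ct sg pi *: phi_osp S sg X].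

(* K_pi (M_1.X_1, ..., M_n.X_n) *)
Definition kappa_dot n (pi : osp n.+1) (M : 'I_n.+1 -> nat)
    (X : 'I_n.+1 -> A) : B :=
  \sum_(sg : osp n.+1 | osp_le sg pi) ct sg pi *: phi_osp_dot S sg M X.

Definition extensivity : Prop :=
  forall n (pi : osp n.+1) (N : nat) (X : 'I_n.+1 -> A), (0 < N)%N ->
    kappa_dot pi (fun=> N) X = kappa pi X *+ (N ^ size pi)%N.

Definition cumulant_axioms : Prop :=
  [/\ multilinearity, universality & extensivity].

End CumulantAxioms.

(* Main.v *)
Require Import Defs.
From mathcomp Require Import all_boot all_order all_algebra.
From mathcomp Require Import complex reals.
From mathcomp Require Import finmap zify.
From mathcomp Require classical_sets.

(** An ordered set partition pi of [n] is the total preorder k <= l iff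
    pi(k) <= pi(l) on [n]. In these terms refinement is inclusion, the quasi-meet
    is the lexicographic product and the ordered kernel of i compares the i_k
    ([osp_leP], [eq_osp], [qmeet_le], [okernel_le]).

    Expand phi_pi(N_{pi(1)}.X_1, ..., N_{pi(n)}.X_n) over the indices i and
    collect those with a given quasi-meet sigma of pi and the kernel of i. There
    are none unless sigma <= pi, and otherwise i amounts to choosing for each
    block P_j of pi the set of values of i on P_j: a set of s_j numbers below
    N_j, where s_j is the number of blocks of sigma inside P_j
    ([card_okernel_fiber]). Hence
      phi_pi(N_{pi(1)}.X_1, ...) =
        sum_{sigma <= pi} prod_j binom(N_j, s_j) phi_sigma(X_1, ..., X_n),
    which is visibly a polynomial. Its values at positive integers determine its
    coefficients ([poly_vanish]), so K_pi is the combination of the phi_sigma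
    given by the coefficients of N_1 ... N_p on the right ([cumulantE]).

    Multilinearity of K_pi follows from that of the moments. The coefficient of
    phi_pi is 1, so the system is unitriangular for the order on ordered set
    partitions and can be solved for the phi_pi ([inv_coefP]); this is
    universality. For extensivity, c N_j copies of a variable are N_j groups of c
    copies ([qmeet_okernel_nested]), so phi_pi(c N_{pi(1)}.X_1, ...) is also the
    expansion above with phi_sigma(c.X_1, ..., c.X_n) in place of
    phi_sigma(X_1, ..., X_n). Comparing the coefficients of N_1 ... N_p in the
    two expansions gives K_pi(c.X_1, ..., c.X_n) = c^p K_pi(X_1, ..., X_n)
    ([cumulant_extensive]). *)

Set Implicit Arguments.
Unset Strict Implicit.
Unset Printing Implicit Defensive.

Import GRing.Theory Num.Theory.

(** * Ordered set partitions as total preorders *)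

(** An order comparison between level functions spreads from low levels to
    high ones: at a counterexample x of least level j x, the value j x is also
    taken by i, at some y, and y is a counterexample of lower level. *)
Lemma leq_of_mono (T : Type) (P : T -> Prop) (i j : T -> nat) :
  (forall x y, P x -> P y -> i x < i y -> j x < j y) ->
  (forall x, P x -> j x < i x -> exists2 y, P y & i y = j x) ->
  forall x, P x -> i x <= j x.
Proof.
move=> mono ex x; have [v] := ubnP (j x).
elim: v x => // v IHv x; rewrite ltnS => jxv Px.
rewrite leqNgt; apply/negP => ji.
have [y Py iy] := ex x Px ji.
have jyx : j y < j x by apply: mono => //; rewrite iy.
by have := IHv y (leq_trans jyx jxv) Py; rewrite iy leqNgt jyx.
Qed.

Lemma leq_lex (a a' b b' m : nat) : b < m -> b' < m ->
  (a * m + b <= a' * m + b') = (a < a') || (a == a') && (b <= b').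
Proof.
move=> bm b'm; case: (ltngtP a a') => [aa'|aa'|->] /=;
  last by rewrite leq_add2l.
  have : a.+1 * m <= a' * m by rewrite leq_mul2r aa' orbT.
  by rewrite mulSn; lia.
have : a'.+1 * m <= a * m by rewrite leq_mul2r aa' orbT.
by rewrite mulSn; lia.
Qed.

(** The empty sets dropped from the list of intersections in a quasi-meet do
    not change the order in which the others occur. *)
Lemma leq_find_filter (T : Type) (p a b : pred T) (s : seq T) :
  subpred a p -> subpred b p ->
  (find a (filter p s) <= find b (filter p s)) = (find a s <= find b s).
Proof.
move=> ap bp; elim: s => //= x s IHs.
case: ifP => px /=; first by case: ifP => //; case: ifP.
by rewrite (contraFF (ap x) px) (contraFF (bp x) px).
Qed.

Section PreorderView.
Context (n : nat).
Implicit Types (pi sg rho : osp n) (k l : 'I_n).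

Lemma mem_block pi k (v : nat) :
  k \in nth set0 pi v -> block_index pi k = v :> nat.
Proof.
case: (ltnP v (size pi)) => [vp|pv]; last by rewrite nth_default ?inE.
by rewrite block_indexE // => /eqP.
Qed.

Lemma block_index_mem pi k : k \in nth set0 pi (block_index pi k).
Proof. by rewrite block_indexE. Qed.

Lemma block_index_surj pi (v : nat) :
  v < size pi -> exists k, block_index pi k = v :> nat.
Proof.
move=> vp; have /and3P[p0 _ _] := ospP pi.
have /set0Pn[k kP] : nth set0 pi v != set0.
  by apply: contraNneq p0 => <-; rewrite mem_nth.
by exists k; apply: mem_block.
Qed.

(** The order on ordered set partitions is inclusion of the total preorders
    k <= l iff pi(k) <= pi(l). Equal indices give refinement, strict ones the
    compatibility of the two orders of blocks. *)
Lemma osp_leP pi sg :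
  reflect (forall k l, block_index pi k <= block_index pi l ->
                       block_index sg k <= block_index sg l)
          (osp_le pi sg).
Proof.
apply: (iffP andP) => [[/forall_inP ref /forallP ord] k l kl|mono].
  have find_sup x : nth set0 pi (block_index pi x) \subset
                    nth set0 sg (block_index sg x).
    have /ref/existsP[Q /andP[]] :
        nth set0 pi (block_index pi x) \in [set:: pi] by rewrite inE mem_nth.
    rewrite inE => /(nthP set0)[v vs <-] sub; have := subsetP sub x.
    by move=> /(_ (block_index_mem _ _))/mem_block->.
  move: kl; rewrite leq_eqVlt => /orP[/eqP kl|kl].
    have := subsetP (find_sup k) l; rewrite kl block_index_mem => /(_ isT).
    by move/mem_block->.
  have /forallP/(_ (block_index pi l))/forallP/(_ (block_index sg k)) :=
    ord (block_index pi k).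
  by move=> /forallP/(_ (block_index sg l))/implyP; apply; rewrite kl !find_sup.
split.
  apply/forall_inP => P; rewrite inE => /(nthP set0)[v vp <-].
  have [k kv] := block_index_surj vp.
  apply/existsP; exists (nth set0 sg (block_index sg k)).
  rewrite inE mem_nth ?block_index_proof //=.
  apply/subsetP => l /mem_block lv; rewrite block_indexE ?block_index_proof //.
  by rewrite eqn_leq !mono // lv kv.
apply/forallP => v; apply/forallP => w; apply/forallP => v'; apply/forallP => w'.
apply/implyP => /and3P[vw vv' ww'].
have [k kv] := block_index_surj (ltn_ord v).
have [l lw] := block_index_surj (ltn_ord w).
have kl : block_index sg k <= block_index sg l by rewrite mono // kv lw ltnW.
rewrite -(mem_block (subsetP vv' k _)) -?(mem_block (subsetP ww' l _)) //.
  by rewrite -lw block_index_mem.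
by rewrite -kv block_index_mem.
Qed.

Lemma osp_le_refl : reflexive (@osp_le n).
Proof. by move=> pi; apply/osp_leP. Qed.

Lemma osp_le_trans : transitive (@osp_le n).
Proof.
move=> pi sg rho /osp_leP le1 /osp_leP le2; apply/osp_leP => k l kl.
exact/le2/le1.
Qed.

Lemma leq_block_index pi sg :
  (forall k l, block_index pi k < block_index pi l ->
               block_index sg k < block_index sg l) ->
  forall k, block_index pi k <= block_index sg k.
Proof.
move=> mono k.
apply: (@leq_of_mono _ (fun=> True) (fun k => block_index pi k : nat)
  (fun k => block_index sg k : nat)) => // [x y _ _|x _ lt].
  exact: mono.
have [y yE] := block_index_surj (ltn_trans lt (ltn_ord _)).
by exists y.
Qed.

Lemma eq_okernel (i j : 'I_n -> nat) : i =1 j -> okernel i = okernel j.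
Proof.
move=> ij; apply/val_inj/val_inj; rewrite /= /okernel_seq.
have -> : [seq i k | k : 'I_n] = [seq j k | k : 'I_n] by apply: eq_codom.
apply: eq_map => v.
by apply/setP => k; rewrite !inE ij.
Qed.

(** The preorder determines the partition: block indices take all the values
    0, ..., p-1, so pi(k) is the height of k in the preorder. *)
Lemma eq_osp pi sg :
  (forall k l, (block_index pi k <= block_index pi l) =
               (block_index sg k <= block_index sg l)) ->
  pi = sg.
Proof.
move=> same; rewrite -(okernel_block_index pi) -(okernel_block_index sg).
apply: eq_okernel => k; apply/eqP; rewrite eqn_leq.
by rewrite !leq_block_index // => {}k l; rewrite !ltnNge same.
Qed.

Lemma osp_le_anti : antisymmetric (@osp_le n).
Proof.
move=> pi sg /andP[/osp_leP le1 /osp_leP le2]; apply: eq_osp => k l.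
by apply/idP/idP => [/le1|/le2].
Qed.

Lemma osp_lt_irr : irreflexive (@osp_lt n).
Proof. by move=> pi; rewrite /osp_lt eqxx. Qed.

Lemma osp_lt_trans : transitive (@osp_lt n).
Proof.
move=> pi sg rho /andP[neq le] /andP[_ le']; apply/andP; split.
  by apply: contraNneq neq => E; rewrite E in le *; apply/eqP/osp_le_anti/andP.
exact: osp_le_trans le'.
Qed.

Lemma okernel_le (i : 'I_n -> nat) k l :
  (block_index (okernel i) k <= block_index (okernel i) l) = (i k <= i l).
Proof.
set s := sort leq (undup [seq i k | k : 'I_n]).
have mem x : i x \in s by rewrite mem_sort mem_undup map_f ?mem_enum.
have ss : sorted leq s by apply: (sort_sorted leq_total).
have E x : block_index (okernel i) x = seq.index (i x) s :> nat.
  by rewrite /= find_map; apply: eq_find => v; rewrite /= inE eq_sym.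
rewrite !E; apply/idP/idP.
  exact: (sorted_leq_index leq_trans leqnn ss).
rewrite leq_eqVlt => /orP[/eqP-> //|]; rewrite ltnNge; apply: contraNT.
rewrite -ltnNge => /ltnW.
exact: (sorted_leq_index leq_trans leqnn ss).
Qed.

Lemma find_allpairs_setI (s t : seq {set 'I_n}) k :
  has (fun P : {set 'I_n} => k \in P) s ->
  has (fun P : {set 'I_n} => k \in P) t ->
  find (fun P : {set 'I_n} => k \in P) [seq P :&: Q | P <- s, Q <- t] =
  find (fun P : {set 'I_n} => k \in P) s * size t +
  find (fun P : {set 'I_n} => k \in P) t.
Proof.
move=> + kt; elim: s => //= P s IHs ks.
rewrite find_cat has_map find_map size_map.
have [kP|kP] /= := boolP (k \in P).
  have E : preim (setI P) (fun P0 : {set 'I_n} => k \in P0) =1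
           (fun P : {set 'I_n} => k \in P) by move=> Q /=; rewrite inE kP.
  by rewrite (eq_has E) (eq_find E) kt.
have E : preim (setI P) (fun P0 : {set 'I_n} => k \in P0) =1 pred0.
  by move=> Q /=; rewrite inE (negbTE kP).
by rewrite (eq_has E) has_pred0 IHs ?mulSn ?addnA //; rewrite (negbTE kP) in ks.
Qed.

(** The intersections are listed row by row, so an element of the intersection of
    the v-th block of pi and the w-th block of sg sits at position
    v * size sg + w: positions compare lexicographically. *)
Lemma qmeet_le pi sg k l :
  (block_index (qmeet pi sg) k <= block_index (qmeet pi sg) l) =
  (block_index pi k < block_index pi l) ||
  (block_index pi k == block_index pi l :> nat) &&
  (block_index sg k <= block_index sg l).
Proof.
have neq0 x (P : {set 'I_n}) : x \in P -> P != set0.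
  by move=> xP; apply/set0Pn; exists x.
rewrite /= /qmeet_seq leq_find_filter; try exact: neq0.
by rewrite !find_allpairs_setI ?osp_has // leq_lex ?block_index_proof.
Qed.

Lemma qmeet_okernel_le pi (i : 'I_n -> nat) k l :
  (block_index (qmeet pi (okernel i)) k <=
   block_index (qmeet pi (okernel i)) l) =
  (block_index pi k < block_index pi l) ||
  (block_index pi k == block_index pi l :> nat) && (i k <= i l).
Proof. by rewrite qmeet_le okernel_le. Qed.

(** The indices k |-> i_k that contribute phi_sigma to a dotted moment: only the
    relative order of the i_k inside each block of pi matters, and it has to be
    the order of the blocks of sigma. This turns the count of such indices into
    a product over the blocks of pi. *)
Lemma qmeet_okernel_eqP pi sg (i : 'I_n -> nat) :
  reflect
    (osp_le sg pi /\
     forall k l, block_index pi k = block_index pi l ->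
       (block_index sg k <= block_index sg l) = (i k <= i l))
    (qmeet pi (okernel i) == sg).
Proof.
apply: (iffP eqP) => [<-|[/osp_leP le same]].
  split; last by move=> k l kl; rewrite qmeet_okernel_le kl ltnn eqxx.
  by apply/osp_leP => k l; rewrite qmeet_okernel_le; lia.
apply: eq_osp => k l; rewrite qmeet_okernel_le.
have := le k l; have := le l k.
case: (ltngtP (block_index pi k) (block_index pi l)) => /=.
- lia.
- lia.
- by move=> kl _ _; rewrite -same //; apply: val_inj.
Qed.

(** An index i = a N + b with b < N is compared by comparing a first and b next,
    which is how a quasi-meet compares; so N N_j copies of a variable can be
    taken as N_j groups of N copies. Extensivity rests on this identity. *)
Lemma qmeet_okernel_nested pi (N : nat) (i a b : 'I_n -> nat) :
  (forall k, b k < N) -> (forall k, i k = a k * N + b k) ->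
  qmeet (qmeet pi (okernel a)) (okernel b) = qmeet pi (okernel i).
Proof.
move=> bN iE; apply: eq_osp => k l.
rewrite !qmeet_okernel_le ltnNge eqn_leq !qmeet_okernel_le !iE leq_lex //.
by case: (ltngtP (block_index pi k) (block_index pi l)) => //=; lia.
Qed.

End PreorderView.

(** * Counting indices with a given quasi-meet *)

(** The order isomorphism from s to t, for increasing lists of the same size. *)
Definition transport (s t : seq nat) (x : nat) : nat := nth 0 t (seq.index x s).

Section Transport.
Context (s t : seq nat).
Hypotheses (ss : sorted ltn s) (st : sorted ltn t) (szst : size s = size t).

Lemma transport_mem x : x \in s -> transport s t x \in t.
Proof. by move=> xs; rewrite mem_nth // -szst index_mem. Qed.

Lemma transport_mono : {in s &, {mono transport s t : x y / x <= y}}.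
Proof.
apply: leq_mono_in => x y xs ys xy; rewrite (sorted_ltn_nth ltn_trans) //.
- by rewrite inE -szst index_mem.
- by rewrite inE -szst index_mem.
rewrite ltnNge; apply: contraL xy => le; rewrite -leqNgt.
exact: (sorted_leq_index leq_trans leqnn (sub_sorted ltnW ss)).
Qed.

Lemma transport_onto y : y \in t -> exists2 x, x \in s & transport s t x = y.
Proof.
move=> /(nthP 0)[v vt <-]; exists (nth 0 s v); first by rewrite mem_nth ?szst.
rewrite /transport index_uniq ?szst //.
by move: ss; rewrite ltn_sorted_uniq_leq => /andP[].
Qed.

End Transport.

Definition vals m (A : {set 'I_m}) : seq nat := [seq val x | x <- enum A].

Lemma vals_sorted m (A : {set 'I_m}) : sorted ltn (vals A).
Proof.
apply: (subseq_sorted ltn_trans _ (iota_ltn_sorted 0 m)).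
by rewrite -val_enum_ord map_subseq // enumT filter_subseq.
Qed.

Lemma size_vals m (A : {set 'I_m}) : size (vals A) = #|A|.
Proof. by rewrite size_map -cardE. Qed.

Lemma mem_vals m (A : {set 'I_m}) (x : 'I_m) :
  ((x : nat) \in vals A) = (x \in A).
Proof. by rewrite mem_map ?mem_enum //; apply: val_inj. Qed.

Lemma leq_card_imset (T U V : finType) (f : T -> U) (g : T -> V) (P : {set T}) :
  {in P &, forall x y, g x = g y -> f x = f y} -> #|f @: P| <= #|g @: P|.
Proof.
have Some_inj : injective (@Some U) by move=> x y [].
move=> fg; rewrite -(card_imset (f @: P) Some_inj).
pose h v := omap f [pick x in P | g x == v].
apply: leq_trans (leq_imset_card h _).
apply/subset_leq_card/subsetP => _ /imsetP[_ /imsetP[x xP ->] ->].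
apply/imsetP; exists (g x); first exact: imset_f.
rewrite /h; case: pickP => [y /andP[yP /eqP gy]|/(_ x)]; last by rewrite xP eqxx.
by rewrite /= (fg x y).
Qed.

Definition block_set n (pi : osp n) (j : 'I_(size pi)) : {set 'I_n} :=
  [set k | block_index pi k == j].

(** The blocks of sg that meet the j-th block of pi, hence lie in it when sg
    refines pi. *)
Definition subblocks n (sg pi : osp n) (j : 'I_(size pi)) : {set 'I_(size sg)} :=
  block_index sg @: block_set j.

Section Count.
Context (n : nat) (pi sg : osp n) (N : 'I_(size pi) -> nat).
Hypothesis le_sg_pi : osp_le sg pi.

Let M := \max_j N j.
Let leNM j : N j <= M. Proof. exact: leq_bigmax. Qed.
Let indices := {dffun forall k : 'I_n, 'I_(N (block_index pi k))}.
Let D : {set indices} :=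
  [set i : indices | qmeet pi (okernel (fun k => i k)) == sg].
Let below (j : 'I_(size pi)) : {set 'I_M} := [set x : 'I_M | x < N j].
Let family_of (j : 'I_(size pi)) : {set {set 'I_M}} :=
  [set A : {set 'I_M} | A \subset below j & #|A| == #|subblocks sg j|].
Let images (i : indices) : {ffun 'I_(size pi) -> {set 'I_M}} :=
  [ffun j => [set widen_ord (leNM (block_index pi k)) (i k) | k in block_set j]].

Let memD (i : indices) : reflect
   (forall k l, block_index pi k = block_index pi l ->
     (block_index sg k <= block_index sg l) = (i k <= i l)) (i \in D).
Proof.
rewrite inE; apply: (iffP (qmeet_okernel_eqP _ _ _)) => [[_ //]|]; by split.
Qed.

Let imagesP (i : indices) j (x : 'I_M) : reflect
   (exists2 k, block_index pi k = j & x = i k :> nat) (x \in images i j).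
Proof.
rewrite ffunE; apply: (iffP imsetP) => [[k]|[k kj xk]].
  by rewrite inE => /eqP kj ->; exists k.
by exists k; [rewrite inE kj | apply: val_inj].
Qed.

(* A level function is determined by its order and its set of values. *)
Let images_inj : {in D &, injective images}.
Proof.
suff le (i i' : indices) : i \in D -> i' \in D -> images i = images i' ->
    forall k, i k <= i' k.
  move=> i i' iD i'D eqi; apply/ffunP => k; apply/val_inj/eqP.
  by rewrite eqn_leq !le.
move=> /memD iD /memD i'D eqi k.
apply: (@leq_of_mono _ (fun l => block_index pi l = block_index pi k)
  (fun l => i l) (fun l => i' l)) => // [x y xk yk|x xk _].
  by rewrite !ltnNge -iD -?i'D ?yk ?xk.
have : widen_ord (leNM (block_index pi x)) (i' x)
    \in images i (block_index pi k).
  by rewrite eqi; apply/imagesP; exists x.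
by move=> /imagesP[y yk /= E]; exists y.
Qed.

(* Conversely the order is prescribed by sg, and any set of values of the right
   size is reached by matching it with the blocks of sg in increasing order. *)
Let images_onto : images @: D = [set f in family family_of].
Proof.
apply/setP => f; rewrite inE; apply/imsetP/familyP => [[i /memD iD ->] j|fF].
  rewrite inE; apply/andP; split.
    by apply/subsetP => x /imagesP[k <- xk]; rewrite inE xk.
  rewrite ffunE eqn_leq; apply/andP; split; apply: leq_card_imset => k l;
    rewrite !inE => /eqP kj /eqP lj.
    move/eqP; rewrite -val_eqE eqn_leq !iD ?kj ?lj // -eqn_leq => /eqP E.
    exact: val_inj.
  move/eqP; rewrite -val_eqE eqn_leq /= -!iD ?kj ?lj // -eqn_leq => /eqP E.
  exact: val_inj.
pose h j := transport (vals (subblocks sg j)) (vals (f j)).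
have szh j : size (vals (subblocks sg j)) = size (vals (f j)).
  by have := fF j; rewrite inE => /andP[_ /eqP E]; rewrite !size_vals E.
have sub k : (block_index sg k : nat) \in vals (subblocks sg (block_index pi k)).
  by rewrite mem_vals imset_f // inE.
have ltN k : h (block_index pi k) (block_index sg k) < N (block_index pi k).
  have /mapP[x + hx] := transport_mem (szh _) (sub k).
  rewrite /h hx mem_enum.
  have := fF (block_index pi k); rewrite inE => /andP[/subsetP + _] xf.
  by move=> /(_ _ xf); rewrite inE.
exists (finfun (fun k => Ordinal (ltN k)) : indices).
  apply/memD => k l kl; rewrite !ffunE /= kl.
  have mono := transport_mono (vals_sorted _) (vals_sorted _)
    (szh (block_index pi l)).
  have := sub k; rewrite kl => subk; rewrite /h mono //; apply: sub.
apply/ffunP => j; apply/setP => x; apply/idP/imagesP => [|[k <-]].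
  rewrite -mem_vals => /(transport_onto (vals_sorted _) (szh j))[_ /mapP[v + ->]].
  rewrite mem_enum => /imsetP[k]; rewrite inE => /eqP kj -> <-.
  by exists k => //; rewrite ffunE /= kj.
rewrite ffunE /= => xE; rewrite -mem_vals xE.
exact: (transport_mem (szh _) (sub k)).
Qed.

(** Sending i to the sets of values that it takes on the blocks of pi is a
    bijection from the indices counted here to the families of sets A_j of
    numbers below N_j, where A_j has as many elements as there are blocks of sg
    inside the j-th block of pi. *)
Lemma card_okernel_fiber :
  #|[set i : {dffun forall k : 'I_n, 'I_(N (block_index pi k))} |
       qmeet pi (okernel (fun k => i k)) == sg]| =
  \prod_j 'C(N j, #|subblocks sg j|).
Proof.
rewrite -(card_in_imset images_inj) images_onto cardsE card_family.
rewrite foldrE big_map big_enum /=; apply: eq_bigr => j _.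
rewrite cards_draws; congr 'C(_, _).
have widen_inj : injective (widen_ord (leNM j)).
  by move=> x y /(congr1 val) /= /ord_inj.
rewrite -[RHS]card_ord -(card_imset _ widen_inj).
apply: eq_card => x; rewrite !inE; apply/idP/imsetP => [xN|[y _ ->] /=] //.
by exists (Ordinal xN) => //; apply: val_inj.
Qed.

End Count.

Local Open Scope ring_scope.

(** * Polynomials and their values at positive integers *)

Section BinomialPolynomial.
Context (K : numFieldType).

(** The polynomial x (x - 1) ... (x - s + 1) / s!, whose value at N is 'C(N, s). *)
Definition binom_poly (s : nat) : {poly K} :=
  (s`!%:R)^-1 *: \prod_(t < s) ('X - t%:R%:P).

Lemma size_binom_poly s : (size (binom_poly s) <= s.+1)%N.
Proof.
apply: leq_trans (size_scale_leq _ _) _.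
by rewrite size_prod_XsubC -[X in size X]enumT size_enum_ord.
Qed.

Lemma horner_binom_poly s N : (binom_poly s).[N%:R] = 'C(N, s)%:R.
Proof.
rewrite hornerZ horner_prod.
under eq_bigr do rewrite hornerXsubC.
suff -> : \prod_(t < s) (N%:R - t%:R) = (N ^_ s)%:R :> K.
  by rewrite -bin_ffact natrM mulrC mulfK // pnatr_eq0 -lt0n fact_gt0.
elim: s => [|s IHs]; first by rewrite big_ord0 ffactn0.
rewrite big_ord_recr /= IHs ffactnSr natrM.
have [le|lt] := leqP s N; first by rewrite natrB.
by rewrite ffact_small // !mul0r.
Qed.

Lemma binom_poly1 : binom_poly 1 = 'X.
Proof. by rewrite /binom_poly big_ord1 invr1 scale1r subr0. Qed.

End BinomialPolynomial.

Section PolynomialFunctions.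
Context (K : numFieldType) (V : lmodType K) (p : nat).

(** The coefficient of x^e of a polynomial of degree < D is a fixed linear
    combination of its values at 1, ..., D, read off the inverse of the
    Vandermonde matrix of these points. *)
Lemma coef_functional (D : nat) : exists lam : 'I_D -> 'I_D -> K,
  forall e m : 'I_D, \sum_(w < D) lam e w * w.+1%:R ^+ m = (m == e)%:R.
Proof.
pose a : 'rV[K]_D := \row_w w.+1%:R.
have unitV : Vandermonde D a \in unitmx.
  rewrite unitmxE det_Vandermonde unitfE.
  apply/prodf_neq0 => i _; apply/prodf_neq0 => j ij.
  by rewrite !mxE subr_eq0 eqr_nat eqSS neq_ltn ij orbT.
exists (fun e w => invmx (Vandermonde D a) w e) => e m.
have /matrixP/(_ m e) := mulmxV unitV; rewrite !mxE => <-.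
by apply: eq_bigr => w _; rewrite !mxE mulrC.
Qed.

(** Products of these functionals, one for each variable, extract a coefficient
    from the values at positive integers. The functionals act linearly on the
    coefficients, which may therefore lie in any module over K. *)
Lemma poly_vanish (s : seq {ffun 'I_p -> nat}) (a : {ffun 'I_p -> nat} -> V) :
  uniq s ->
  (forall N : 'I_p -> nat, (forall k, (0 < N k)%N) ->
     \sum_(m <- s) a m *+ (\prod_k N k ^ m k)%N = 0) ->
  forall m, m \in s -> a m = 0.
Proof.
move=> us vanish e es.
pose D := (\max_(m <- s) \max_k m k).+1.
have ltD m k : m \in s -> (m k < D)%N.
  move=> ms; rewrite ltnS; apply: leq_trans (leq_bigmax k) _.
  by apply: (@leq_bigmax_seq _ _ _ (fun m : {ffun 'I_p -> nat} => \max_k m k)).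
have [lam lamP] := coef_functional D.
pose u k := lam (Ordinal (ltD e k es)).
have extract m : m \in s ->
    \sum_(w : {ffun 'I_p -> 'I_D})
      (\prod_k u k (w k)) *: (a m *+ (\prod_k (w k).+1 ^ m k)%N) =
    (m == e)%:R *: a m.
  move=> ms; under eq_bigr do rewrite -scaler_nat scalerA natr_prod -big_split.
  rewrite -scaler_suml; congr (_ *: _).
  rewrite -(bigA_distr_bigA (fun k (w : 'I_D) => u k w * (w.+1 ^ m k)%:R)) /=.
  under eq_bigr => k _.
    under eq_bigr do rewrite natrX -[X in _ ^+ X]/(Ordinal (ltD m k ms) : nat).
    rewrite lamP -val_eqE /=; over.
  rewrite -natr_prod; congr (_%:R).
  have [->|neq] := eqVneq m e; first by rewrite big1 // => k _; rewrite eqxx.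
  have [k kP] : exists k, m k != e k.
    by apply/existsP; rewrite -negb_forall; apply: contraNN neq => /forallP E;
       apply/eqP/ffunP => k; apply/eqP.
  by rewrite (bigD1 k) //= (negbTE kP).
have <- : \sum_(w : {ffun 'I_p -> 'I_D}) (\prod_k u k (w k)) *:
    (\sum_(m <- s) a m *+ (\prod_k (w k).+1 ^ m k)%N) = a e.
  under eq_bigr do rewrite scaler_sumr.
  rewrite exchange_big /= (bigD1_seq e) //= extract // eqxx scale1r.
  rewrite big1_seq ?addr0 // => m /andP[me ms].
  by rewrite extract // (negbTE me) scale0r.
by rewrite big1 // => w _; rewrite (vanish (fun k => (w k).+1)) ?scaler0.
Qed.

Lemma vpoly_eval_sub (f : vpoly p V) (s : {fset {ffun 'I_p -> nat}}) N :
  (finsupp f `<=` s)%fset ->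
  vpoly_eval f N = \sum_(m <- s) f m *+ (\prod_k N k ^ m k)%N.
Proof.
move=> sub; apply: big_fset_incl => // m _ /fsfun_dflt ->.
by rewrite mul0rn.
Qed.

(** For c = 1, a polynomial is determined by its values at positive integers. For
    general c, the substitution N |-> c N multiplies the coefficient of
    N_1 ... N_p by c^p, which is what extensivity asks for. *)
Lemma vpoly_dilation (f g : vpoly p V) (c : nat) :
  (forall N : 'I_p -> nat, (forall k, (0 < N k)%N) ->
     vpoly_eval f (fun k => N k * c)%N = vpoly_eval g N) ->
  forall m, g m = f m *+ (c ^ \sum_k m k)%N.
Proof.
move=> fg m; pose s := (finsupp f `|` finsupp g)%fset.
have [ms|] := boolP (m \in s); last first.
  rewrite in_fsetU negb_or => /andP[/fsfun_dflt -> /fsfun_dflt ->].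
  by rewrite mul0rn.
apply/eqP; rewrite eq_sym -subr_eq0; apply/eqP.
apply: (poly_vanish (a := fun l => f l *+ (c ^ \sum_k l k)%N - g l)
  (fset_uniq s)) ms => N N0.
have := fg N N0; rewrite !(@vpoly_eval_sub _ s) ?fsubsetUl ?fsubsetUr //.
move/eqP; rewrite -subr_eq0 => /eqP fgN; apply: etrans fgN.
rewrite -sumrB; apply: eq_bigr => l _.
rewrite mulrnBl -mulrnA; congr (_ *+ _ - _).
under [RHS]eq_bigr do rewrite expnMn.
by rewrite big_split /= expn_sum mulnC.
Qed.

Lemma vpoly_of_coef (D : nat) (a : {ffun 'I_p -> nat} -> V) :
  exists2 f : vpoly p V,
    forall N, vpoly_eval f N =
      \sum_(t : {ffun 'I_p -> 'I_D})
        a [ffun k => t k : nat] *+ (\prod_k N k ^ t k)%N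
  & forall t : {ffun 'I_p -> 'I_D},
      f [ffun k => t k : nat] = a [ffun k => t k : nat].
Proof.
pose h (t : {ffun 'I_p -> 'I_D}) : {ffun 'I_p -> nat} := [ffun k => t k : nat].
have h_inj : injective h.
  move=> t t' /ffunP E; apply/ffunP => k; have := E k.
  by rewrite !ffunE => /ord_inj.
pose s := [fset h t | t in {ffun 'I_p -> 'I_D}]%fset.
pose f : vpoly p V := [fsfun m in s => a m | 0].
have fE t : f (h t) = a (h t) by rewrite fsfun_fun in_imfset.
exists f => // N; rewrite (@vpoly_eval_sub _ s) ?finsupp_sub //.
rewrite big_imfset /=; last by move=> t t' _ _; apply: h_inj.
rewrite big_enum /=; apply: eq_bigr => t _; rewrite -/(h t) fE; congr (_ *+ _).
by apply: eq_bigr => k _; rewrite ffunE.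
Qed.

End PolynomialFunctions.

(** * Polynomial expansion of dotted moments *)

Section DotPolynomial.
Context (K : numFieldType) (V : lmodType K) (n : nat).
Context (pi : osp n) (psi : osp n -> V).

(** The sum that defines phi_rho(M_1.X_1, ..., M_n.X_n), with an arbitrary family
    psi in place of the moments phi_sigma(X_1, ..., X_n): extensivity applies
    the polynomial expansion below to phi_sigma(c.X_1, ..., c.X_n) as well. *)
Definition dot_sum (rho : osp n) (M : 'I_n -> nat) : V :=
  \sum_(i : {dffun forall k : 'I_n, 'I_(M k)})
    psi (qmeet rho (okernel (fun k => i k))).

Lemma dot_sumE (N : 'I_(size pi) -> nat) :
  dot_sum pi (fun k => N (block_index pi k)) =
  \sum_(sg | osp_le sg pi) psi sg *+ (\prod_j 'C(N j, #|subblocks sg j|))%N.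
Proof.
pose qm (i : {dffun forall k : 'I_n, 'I_(N (block_index pi k))}) :=
  qmeet pi (okernel (fun k => i k)).
rewrite /dot_sum (partition_big qm (fun sg => osp_le sg pi)) /=; last first.
  by move=> i _; have [] := elimT (qmeet_okernel_eqP _ _ _) (eqxx (qm i)).
apply: eq_bigr => sg le; rewrite -(card_okernel_fiber _ le) -sumr_const.
rewrite big_mkcond [RHS]big_mkcond /=.
by apply: eq_bigr => i _; rewrite inE /qm; case: eqP => // ->.
Qed.

(** The coefficient of N_1 ... N_p in the product of the 'C(N_j, s_j), where s_j
    is the number of blocks of sg inside the j-th block of rho. *)
Definition kappa_coef (sg rho : osp n) : K :=
  \prod_(j < size rho) (binom_poly K #|subblocks sg j|)`_1.

(** Expanding a product of polynomials in separate variables multiplies their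
    coefficients, so every coefficient of the product of the 'C(N_j, s_j) is a
    product over j. *)
Lemma dot_sum_vpoly : exists2 f : vpoly (size pi) V,
  forall N, dot_sum pi (fun k => N (block_index pi k)) = vpoly_eval f N
  & f [ffun=> 1%N] = \sum_(sg | osp_le sg pi) kappa_coef sg pi *: psi sg.
Proof.
pose q (sg : osp n) (j : 'I_(size pi)) := binom_poly K #|subblocks sg j|.
pose a (m : {ffun 'I_(size pi) -> nat}) : V :=
  \sum_(sg | osp_le sg pi) (\prod_j (q sg j)`_(m j)) *: psi sg.
(* The degree in each N_j is at most the number of blocks, hence at most n; the
   bound n.+2 leaves room for the exponent 1 even if n = 0. *)
have [f evalf fE] := vpoly_of_coef n.+2 a.
exists f => [N|]; last first.
  pose t1 : {ffun 'I_(size pi) -> 'I_n.+2} := [ffun=> inord 1].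
  have -> : [ffun=> 1%N] = [ffun k => t1 k : nat].
    by apply/ffunP => k; rewrite !ffunE inordK.
  rewrite fE; apply: eq_bigr => sg _; congr (_ *: _); apply: eq_bigr => j _.
  by rewrite !ffunE inordK.
rewrite dot_sumE evalf.
under [RHS]eq_bigr do rewrite -scaler_nat scaler_sumr.
rewrite exchange_big /=; apply: eq_bigr => sg _.
under [RHS]eq_bigr do rewrite scalerA natr_prod -big_split /=.
rewrite -scaler_suml -scaler_nat natr_prod; congr (_ *: _).
transitivity (\prod_j \sum_(e < n.+2) (N j ^ e)%:R * (q sg j)`_e).
  apply: eq_bigr => j _; rewrite -horner_binom_poly (@horner_coef_wide _ n.+2).
    by apply: eq_bigr => e _; rewrite natrX mulrC.
  apply: leq_trans (size_binom_poly _ _) _; rewrite ltnS leqW //.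
  apply: leq_trans (max_card _) _; rewrite card_ord.
  exact: is_osp_size (ospP sg).
rewrite bigA_distr_bigA; apply: eq_bigr => t _; apply: eq_bigr => j _.
by rewrite ffunE.
Qed.

(** Division with remainder i_k = a_k c + b_k splits the range of each index; see
    [qmeet_okernel_nested]. *)
Lemma dot_sum_dilation (c : nat) (N : 'I_n -> nat) : (0 < c)%N ->
  dot_sum pi (fun k => N k * c)%N =
  \sum_(a : {dffun forall k : 'I_n, 'I_(N k)})
    dot_sum (qmeet pi (okernel (fun k => a k))) (fun=> c).
Proof.
move=> c0; rewrite /dot_sum pair_big /=.
pose I := {dffun forall k : 'I_n, 'I_(N k * c)}.
pose J := {dffun forall k : 'I_n, 'I_(N k)}.
pose C := {dffun forall k : 'I_n, 'I_c}.
have encP (ab : J * C) k : (ab.1 k * c + ab.2 k < N k * c)%N.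
  have := leq_mul2r c (ab.1 k).+1 (N k); rewrite ltn_ord orbT mulSn => le.
  by apply: leq_trans le; rewrite addnC ltn_add2r.
have decP1 (i : I) k : (i k %/ c < N k)%N by rewrite ltn_divLR.
have decP2 (i : I) k : (i k %% c < c)%N by rewrite ltn_mod.
pose enc ab : I := finfun (fun k => Ordinal (encP ab k)).
pose dec (i : I) : J * C :=
  (finfun (fun k => Ordinal (decP1 i k)) : J,
   finfun (fun k => Ordinal (decP2 i k)) : C).
have enc_bij : bijective enc.
  exists dec => [[a b]|i].
    congr (_, _); apply/ffunP => k; apply/val_inj; rewrite !ffunE /= ffunE /=.
      by rewrite divnMDl // divn_small ?addn0.
    by rewrite modnMDl modn_small.
  by apply/ffunP => k; apply/val_inj; rewrite !ffunE /= !ffunE /= -divn_eq.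
rewrite (reindex enc) /=; last exact: onW_bij.
apply: eq_bigr => -[a b] _; congr psi.
rewrite -(@qmeet_okernel_nested _ _ c (fun k => enc (a, b) k)
  (fun k => a k) (fun k => b k)) // => k.
by rewrite ffunE.
Qed.

End DotPolynomial.

(** * Inversion of a unitriangular system *)

Section Inversion.
Context (K : comNzRingType) (T : finType) (lt : rel T) (a : T -> T -> K).
Hypotheses (lt_irr : irreflexive lt) (lt_trans : transitive lt).

(** The coefficients of the inverse of the unitriangular system with entries
    a z x, by the recursion over chains that solves the equation at x once it is
    solved below x; m bounds the length of the chains. *)
Fixpoint inv_coef (m : nat) (y x : T) : K :=
  if m is m'.+1 then
    - a y x - \sum_(z | lt y z && lt z x) a z x * inv_coef m' y z
  else 0.

(** Moebius inversion. The induction gives x enough fuel as soon as fewer than m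
    elements lie below x, and #|T|.+1 is enough for all x at once. *)
Lemma inv_coefP (V : lmodType K) (f g : T -> V) :
  (forall x, g x = f x + \sum_(y | lt y x) a y x *: f y) ->
  forall x, f x = g x + \sum_(y | lt y x) inv_coef #|T|.+1 y x *: g y.
Proof.
move=> gE x; move: (#|T|.+1) (max_card (lt^~ x) : (_ < #|T|.+1)%N) => m.
elim: m x => // m IHm x; rewrite ltnS => cx.
have fE z : lt z x -> f z = g z + \sum_(y | lt y z) inv_coef m y z *: g y.
  move=> zx; apply: IHm; apply: leq_trans cx; apply: proper_card.
  apply/properP; split; first by apply/subsetP => y yz; apply: lt_trans yz zx.
  by exists z => //; rewrite unfold_in lt_irr.
have -> : f x = g x - \sum_(z | lt z x) a z x *: f z by rewrite gE addrK.
congr (_ + _); rewrite -sumrN.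
under eq_bigr => z zx do rewrite (fE _ zx) scalerDr opprD scaler_sumr -scaleNr.
rewrite big_split sumrN /= (exchange_big_dep (lt^~ x)) /=; last first.
  by move=> z y zx yz; apply: lt_trans yz zx.
rewrite -sumrB; apply: eq_bigr => y yx.
under [X in _ - X = _]eq_bigr do rewrite scalerA.
rewrite -scaler_suml -scalerBl; congr ((_ - _) *: _).
by apply: eq_bigl => z; rewrite andbC.
Qed.

End Inversion.

(** * Multilinearity of the moments *)

Section ProductLinear.
Context (K : comNzRingType) (A : assoc_alg K).

Lemma foldl_amul_linear (s : seq A) : linear (fun u : A => foldl (@amul K A) u s).
Proof.
elim: s => [|x s IHs] c u v //=.
by rewrite [amul (c *: u + v) x]amul_linl IHs.
Qed.

Lemma foldl_amul_linear_in (T : eqType) (F G H : T -> A) (c : K) (t : T) s z :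
  uniq s -> t \in s -> F t = c *: G t + H t ->
  (forall t', t' != t -> F t' = G t') -> (forall t', t' != t -> F t' = H t') ->
  foldl (@amul K A) z (map F s) =
  c *: foldl (@amul K A) z (map G s) + foldl (@amul K A) z (map H s).
Proof.
move=> + + Ft FG FH; elim: s z => //= x s IHs z /andP[xs us].
rewrite inE; have [tx _|tx /= ts] := eqVneq t x.
  rewrite -tx in xs *; rewrite Ft [amul z _]amul_linr foldl_amul_linear /=.
  have neq t' : t' \in s -> t' != t by apply: contraTneq => ->.
  have <- : map F s = map G s by apply/eq_in_map => t' /neq /FG.
  by have <- : map F s = map H s by apply/eq_in_map => t' /neq /FH.
by rewrite IHs // -FG 1?eq_sym // -FH // eq_sym.
Qed.

Lemma aprod_linear n (F G H : 'I_n.+1 -> A) (c : K) (k : 'I_n.+1) :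
  F k = c *: G k + H k ->
  (forall l, l != k -> F l = G l) -> (forall l, l != k -> F l = H l) ->
  aprod F = c *: aprod G + aprod H.
Proof.
move=> Fk FG FH; rewrite /aprod; case: (unliftP ord0 k) => [k'|] kE.
  rewrite -FG -?FH ?kE ?neq_lift //.
  apply: (foldl_amul_linear_in (t := k')); rewrite -?kE ?enum_uniq ?mem_enum //.
    by move=> l lk; apply: FG; rewrite kE (inj_eq lift_inj).
  by move=> l lk; apply: FH; rewrite kE (inj_eq lift_inj).
rewrite kE in Fk FG FH; rewrite Fk foldl_amul_linear /=.
have neq (l : 'I_n) : lift ord0 l != ord0 by rewrite eq_sym neq_lift.
have <- : [seq F (lift ord0 l) | l : 'I_n] = [seq G (lift ord0 l) | l : 'I_n].
  by apply: eq_codom => l; apply: FG.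
have <- // : [seq F (lift ord0 l) | l : 'I_n] = [seq H (lift ord0 l) | l : 'I_n].
by apply: eq_codom => l; apply: FH.
Qed.

End ProductLinear.

Lemma phi_osp_linear (K : comNzRingType) (A B : assoc_alg K)
    (phi : {linear A -> B}) (S : spreadability_system phi) n (pi : osp n.+1)
    (X : 'I_n.+1 -> A) (k : 'I_n.+1) :
  linear (fun x : A => phi_osp S pi [eta X with k |-> x]).
Proof.
move=> c x y; rewrite /phi_osp -linearP; congr (sp_phi S _).
apply: (aprod_linear (k := k)); rewrite /= ?eqxx ?linearP //.
- by move=> l /negPf->.
- by move=> l /negPf->.
Qed.

(** * The cumulants *)

Section CumulantCoefficients.
Context (K : numFieldType) (A B : assoc_alg K) (phi : {linear A -> B}).
Context (S : spreadability_system phi).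

Lemma dot_polyP n (pi : osp n.+1) (X : 'I_n.+1 -> A) :
  is_dot_poly S X (dot_poly S pi X).
Proof.
apply: classical_sets.xgetPex.
have [f fE _] := dot_sum_vpoly pi (fun sg => phi_osp S sg X).
by exists f => N _; apply: fE.
Qed.

Lemma cumulantE n (pi : osp n.+1) (X : 'I_n.+1 -> A) :
  cumulant S pi X =
  \sum_(sg | osp_le sg pi) kappa_coef K sg pi *: phi_osp S sg X.
Proof.
have [f fE <-] := dot_sum_vpoly pi (fun sg => phi_osp S sg X).
rewrite (@vpoly_dilation _ _ _ (dot_poly S pi X) f 1) ?exp1n // => N N0.
rewrite -fE; apply: etrans (esym (dot_polyP _ N0)).
by apply: eq_bigr => m _; under eq_bigr do rewrite muln1.
Qed.

(** Both sides are the coefficient of N_1 ... N_p in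
    phi_pi(c N_{pi(1)}.X_1, ..., c N_{pi(n)}.X_n): on the right after
    substituting c N_j for N_j, on the left after splitting the indices and
    expanding the outer sum over the values phi_sigma(c.X_1, ..., c.X_n). *)
Lemma cumulant_extensive n (pi : osp n.+1) (c : nat) (X : 'I_n.+1 -> A) :
  (0 < c)%N ->
  \sum_(sg | osp_le sg pi) kappa_coef K sg pi *: phi_osp_dot S sg (fun=> c) X =
  cumulant S pi X *+ (c ^ size pi)%N.
Proof.
move=> c0.
have [g gE <-] := dot_sum_vpoly pi (fun sg => phi_osp_dot S sg (fun=> c) X).
rewrite (@vpoly_dilation _ _ _ (dot_poly S pi X) g c); last first.
  move=> N N0; rewrite -gE -(dot_polyP _ (N := fun k => N k * c)%N) => [|k];
    last by rewrite muln_gt0 N0.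
  exact: (dot_sum_dilation pi (fun sg => phi_osp S sg X)).
rewrite /cumulant; congr (_ *+ (c ^ _)%N).
by under eq_bigr do rewrite ffunE; rewrite sum1_card card_ord.
Qed.

(** Each block of pi contains a single block of pi, and 'C(N, 1) = N. *)
Lemma kappa_coef_refl n (pi : osp n) : kappa_coef K pi pi = 1.
Proof.
apply: big1 => j _; suff -> : subblocks pi j = [set j].
  by rewrite cards1 binom_poly1 coefX.
apply/setP => v; rewrite inE; apply/imsetP/eqP => [[k]|->].
  by rewrite inE => /eqP <- ->.
have [k kj] := block_index_surj (ltn_ord j).
have {}kj : block_index pi k = j by apply: val_inj.
by exists k; rewrite ?inE kj.
Qed.

Definition phi_coef n (sg pi : osp n) : K :=
  inv_coef (@osp_lt n) (@kappa_coef K n) #|{: osp n}|.+1 sg pi.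

Lemma cumulant_axiomsP :
  cumulant_axioms S (@cumulant _ A B phi S)
    (fun n => @phi_coef n.+1) (fun n => @kappa_coef K n.+1).
Proof.
have cumE n (pi : osp n.+1) X : cumulant S pi X = phi_osp S pi X +
    \sum_(sg | osp_lt sg pi) kappa_coef K sg pi *: phi_osp S sg X.
  rewrite cumulantE (bigD1 pi) ?osp_le_refl //= kappa_coef_refl scale1r.
  by congr (_ + _); apply: eq_bigl => sg; rewrite andbC.
split.
- move=> n pi X k c x y; rewrite !cumulantE scaler_sumr -big_split /=.
  apply: eq_bigr => sg _.
  by rewrite phi_osp_linear scalerDr !scalerA mulrC.
- split => [n pi X|n pi|n pi X].
  + exact: (inv_coefP (@osp_lt_irr _) (@osp_lt_trans _) (fun sg => cumE _ sg X)).
  + exact: kappa_coef_refl.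
  + exact: cumE.
- by move=> n pi c X c0; apply: cumulant_extensive.
Qed.

End CumulantCoefficients.

Local Open Scope complex_scope.

Theorem theorem3p12 (R : realType) :
  exists c ct : forall n : nat, osp n.+1 -> osp n.+1 -> R[i],
    forall (A B : assoc_alg R[i]) (phi : {linear A -> B})
           (S : spreadability_system phi),
      cumulant_axioms S (@cumulant _ A B phi S) c ct.
Proof.
exists (fun n => @phi_coef R[i] n.+1), (fun n => @kappa_coef R[i] n.+1).
by move=> A B phi S; apply: cumulant_axiomsP.
Qed.
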